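(* Let $\mathcal{E}$ be a nilpotent evolution algebra of type $[1,2,1,1]$ over an algebraically closed field $\mathbb{F}$ of characteristic not two, and fix $i\in\mathbb{F}$ with $i^2=-1$. Then $\mathcal{E}$ is isomorphic to one of the following evolution algebras, given by the squares of the elements of a natural basis $\{e_1,\ldots,e_5\}$ (products $e_je_k$ with $j\neq k$ are $0$), where in all cases $e_3^2=e_4^2=e_5$, $e_5^2=0$, and: - (1) $e_1^2=e_2$, $e_2^2=e_3$; - (2) $e_1^2=e_2+e_4$, $e_2^2=e_3$; - (3) $e_1^2=e_2+e_3+\beta e_4$, $e_2^2=e_3$, with $\beta\in\mathbb{F}$; - (4) $e_1^2=e_2$, $e_2^2=e_3+i\,e_4$; - (5) $e_1^2=e_2+e_3$, $e_2^2=e_3+i\,e_4$; - (6) $e_1^2=e_2+e_3+i\,e_4$, $e_2^2=e_3+i\,e_4$; - (7) $e_1^2=e_2+e_3-i\,e_4$, $e_2^2=e_3+i\,e_4$. Algebras in different families among (1)–(7) are not isomorphic, and two algebras in family (3) with parameters $\beta,\beta'\in\mathbb{F}$ are isomorphic if and only if either $\beta'=\beta$ or $\beta'=-\beta$.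
   Context: An evolution algebra (finite-dimensional here) is an algebra $\mathcal{E}$ over $\mathbb{F}$ with a basis $\{e_1,\ldots,e_n\}$ (a natural basis) such that $e_je_k=0$ for $j\neq k$; it is automatically commutative, and need not be associative. For an algebra $\mathcal{A}$, $\mathrm{ann}(\mathcal{A})=\{x\in\mathcal{A}: x\mathcal{A}=\mathcal{A}x=0\}$, $\mathrm{ann}^0(\mathcal{A})=0$, and $\mathrm{ann}^j(\mathcal{A})$ is defined by $\mathrm{ann}^j(\mathcal{A})/\mathrm{ann}^{j-1}(\mathcal{A})=\mathrm{ann}(\mathcal{A}/\mathrm{ann}^{j-1}(\mathcal{A}))$. With $\mathcal{A}^1=\mathcal{A}$ and $\mathcal{A}^{k+1}=\sum_{j=1}^k\mathcal{A}^j\mathcal{A}^{k+1-j}$, $\mathcal{A}$ is nilpotent if $\mathcal{A}^m=0$ for some $m$, equivalently $\mathrm{ann}^r(\mathcal{A})=\mathcal{A}$ for some $r$. The type of a finite-dimensional nilpotent algebra $\mathcal{A}$ is the sequence $[n_1,\ldots,n_r]$, where $r$ is the least natural number with $\mathrm{ann}^r(\mathcal{A})=\mathcal{A}$ and $n_j=\dim\mathrm{ann}^j(\mathcal{A})-\dim\mathrm{ann}^{j-1}(\mathcal{A})$. *)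

(* Defs.v *)
From HB Require Import structures.
From mathcomp Require Import all_boot all_order all_algebra.

Set Implicit Arguments.
Unset Strict Implicit.
Unset Printing Implicit Defensive.

Import GRing.Theory.
Local Open Scope ring_scope.

(* Finite-dimensional algebras, neither associative nor unital in general.   *)
Structure algebra (F : fieldType) := Algebra {
  alg_sort :> vectType F;
  amul : {bilinear alg_sort -> alg_sort -> alg_sort}
}.
Arguments amul {F a}.

Definition alg_iso (F : fieldType) (A B : algebra F) : Prop :=
  exists f : {linear A -> B},
    bijective f /\ forall x y, f (amul x y) = amul (f x) (f y).

Definition natural_basis (F : fieldType) (A : algebra F) n (e : n.-tuple A) :=
  basis_of {:A} e /\
  forall j k, j != k -> amul (tnth e j) (tnth e k) = 0.

Definition evolution_algebra (F : fieldType) (A : algebra F) : Prop :=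
  exists n, exists e : n.-tuple A, natural_basis e.

Section Annihilator.
Variables (F : fieldType) (A : algebra F).
Implicit Types (U : {vspace A}) (x y : A).

(* It is enough to annihilate a basis, see annP.                             *)
Definition ann : {vspace A} :=
  (\bigcap_(i < \dim {:A})
     (lker (linfun (amul^~ (vbasis {:A})`_i)) :&:
      lker (linfun (amul (vbasis {:A})`_i))))%VS.

Lemma annP x : x \in ann <-> forall y, amul x y = 0 /\ amul y x = 0.
Proof.
have Er z : linfun (amul^~ z) =1 amul^~ z by exact: (lfunE (applyr amul z)).
have El z : linfun (amul z) =1 amul z by exact: lfunE.
split=> [xA y | xA]; last first.
  rewrite memvE; apply/subv_bigcapP => i _; rewrite -memvE memv_cap !memv_ker.
  by rewrite Er El; case: (xA (vbasis {:A})`_i) => -> ->; rewrite eqxx.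
move: xA; rewrite memvE => /subv_bigcapP xA.
have xi i : amul x (vbasis {:A})`_i = 0 /\ amul (vbasis {:A})`_i x = 0.
  case: (ltnP i (\dim {:A})) => [lti | lei].
    have := xA (Ordinal lti) isT.
    rewrite -memvE memv_cap !memv_ker Er El /=.
    by move=> /andP[/eqP-> /eqP->].
  by rewrite nth_default ?size_tuple // linear0r linear0l.
rewrite (coord_vbasis (memvf y)); split.
  rewrite linear_sumr big1 // => i _.
  by rewrite linearZr_LR; case: (xi i) => -> _; rewrite /= scaler0.
rewrite linear_sumlz big1 // => i _.
by rewrite linearZl_LR; case: (xi i) => _ ->; rewrite /= scaler0.
Qed.

Definition ideal U :=
  forall x y, x \in U -> amul x y \in U /\ amul y x \in U.

(* The quotient A / U, carried by the complement U^C that the library        *)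
(* provides. The lemmas below show that quot_proj U is onto, has kernel U,   *)
(* and is multiplicative when U is an ideal.                                 *)
Definition quot_proj_fun U x : subvs_of U^C := vsproj U^C (x - projv U x).

Fact quot_proj_fun_linear U : linear (quot_proj_fun U).
Proof.
move=> a x y; rewrite /quot_proj_fun -linearP; congr (vsproj _ _).
by rewrite linearP scalerBr opprD addrACA.
Qed.
HB.instance Definition _ U :=
  GRing.isLinear.Build F A (subvs_of U^C) _ (quot_proj_fun U)
    (quot_proj_fun_linear U).

Definition quot_proj U : 'Hom(A, subvs_of U^C) := linfun (quot_proj_fun U).

Definition quot_mul U (x y : subvs_of U^C) : subvs_of U^C :=
  quot_proj U (amul (vsval x) (vsval y)).

Fact quot_mul_bilinear U : bilinear_for *:%R *:%R (@quot_mul U).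
Proof.
by split=> [y|x] a u v; rewrite /quot_mul linearP /= ?linearPl ?linearPr linearP.
Qed.
HB.instance Definition _ U :=
  bilinear_isBilinear.Build F (subvs_of U^C) (subvs_of U^C) (subvs_of U^C)
    _ _ (@quot_mul U) (quot_mul_bilinear U).

Definition quot_alg U : algebra F :=
  @Algebra F (subvs_of U^C) (@quot_mul U).

End Annihilator.

(* ann_ser A j is ann^j(A): the preimage in A of the annihilator of          *)
(* A / ann^(j-1)(A).                                                         *)
Fixpoint ann_ser (F : fieldType) (A : algebra F) (j : nat) : {vspace A} :=
  if j is j'.+1 then
    (quot_proj (ann_ser A j') @^-1: ann (quot_alg (ann_ser A j')))%VS
  else 0%VS.

Section AnnihilatorTheory.
Variables (F : fieldType) (A : algebra F).
Implicit Types (U : {vspace A}) (x y : A).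

Lemma lker_quot_proj U : lker (quot_proj U) = U.
Proof.
apply/vspaceP=> x; rewrite memv_ker lfunE /= /quot_proj_fun.
apply/eqP/idP => [x0 | xU]; last by rewrite projv_id // subrr linear0.
have /vsprojK := memv_projC U x; rewrite x0 linear0 => /esym/eqP.
by rewrite subr_eq0 => /eqP->; apply: memv_proj.
Qed.

Lemma quot_proj_eq0 U x : (quot_proj U x == 0) = (x \in U).
Proof. by rewrite -memv_ker lker_quot_proj. Qed.

Lemma quot_proj_val U (z : subvs_of U^C) : quot_proj U (vsval z) = z.
Proof.
rewrite lfunE /= /quot_proj_fun.
suff ->: projv U (vsval z) = 0 by rewrite subr0 vsvalK.
apply/eqP; rewrite -memv0 -(capv_compl U) memv_cap memv_proj /=.
rewrite -[projv _ _](subKr (vsval z)).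
by rewrite rpredB ?subvsP ?memv_projC.
Qed.

Lemma quot_proj_onto U : limg (quot_proj U) = fullv.
Proof.
apply/eqP; rewrite eqEsubv subvf; apply/subvP=> z _.
by rewrite -(quot_proj_val z) memv_img ?memvf.
Qed.

Lemma quot_projM U : ideal U ->
  forall x y, quot_proj U (amul x y) =
              amul (quot_proj U x : quot_alg U) (quot_proj U y).
Proof.
move=> idU x y; rewrite /= /quot_mul; apply/eqP; rewrite -subr_eq0 -linearB quot_proj_eq0.
set x' := vsval _; set y' := vsval _.
have xU z : z - vsval (quot_proj U z) \in U.
  by rewrite -quot_proj_eq0 linearB /= quot_proj_val subrr.
have ->: amul x y - amul x' y' = amul (x - x') y + amul x' (y - y').
  by rewrite linearBl linearBr addrA subrK.
by rewrite rpredD //; [case: (idU _ y (xU x)) | case: (idU _ x' (xU y))].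
Qed.

Lemma mem_preim_ann U x :
  x \in (quot_proj U @^-1: ann (quot_alg U))%VS <->
  forall z : quot_alg U, amul (quot_proj U x : quot_alg U) z = 0
                         /\ amul z (quot_proj U x) = 0.
Proof. by rewrite -memv_preim; apply: (@annP F (quot_alg U)). Qed.

Lemma ann_ser_ideal j : ideal (ann_ser A j).
Proof.
elim: j => [x y|j IHj x y].
  by rewrite memv0 => /eqP->; rewrite linear0l linear0r mem0v.
move=> /mem_preim_ann xU; split; apply/mem_preim_ann=> z.
  rewrite quot_projM //; case: (xU (quot_proj _ y)) => -> _.
  by rewrite linear0l linear0r.
rewrite quot_projM //; case: (xU (quot_proj _ y)) => _ ->.
by rewrite linear0l linear0r.
Qed.

Lemma ann_serS j x : x \in ann_ser A j.+1 <->
  forall y, amul x y \in ann_ser A j /\ amul y x \in ann_ser A j.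
Proof.
have idU := @ann_ser_ideal j; split=> [/mem_preim_ann xU y | xU].
  rewrite -!quot_proj_eq0 !quot_projM //.
  by case: (xU (quot_proj _ y)) => -> ->; rewrite eqxx.
apply/mem_preim_ann=> z; rewrite -(quot_proj_val z) -!quot_projM //.
case: (xU (vsval z)).
by rewrite -!quot_proj_eq0 => /eqP-> /eqP->.
Qed.

End AnnihilatorTheory.

Section Nilpotent.
Variables (F : fieldType) (A : algebra F).
Implicit Types (U W : {vspace A}).

Definition prod_vs U W : {vspace A} :=
  <<[seq amul x y | x <- vbasis U, y <- vbasis W]>>%VS.

(* The sequence [:: A^1; ...; A^k], each term of which depends on all the    *)
(* previous ones; see alg_powS for the recursion.                            *)
Fixpoint alg_pows (k : nat) : seq {vspace A} :=
  if k is k'.+1 then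
    let s := alg_pows k' in
    rcons s (if k' is 0 then fullv
             else \sum_(j < k') prod_vs (nth 0 s j) (nth 0 s (k' - j.+1)))%VS
  else [::].

(* A^k, for k > 0.                                                           *)
Definition alg_pow (k : nat) : {vspace A} := nth 0%VS (alg_pows k) k.-1.

Definition nilpotent_alg : Prop :=
  exists2 m, (0 < m)%N & alg_pow m = 0%VS.

Lemma size_alg_pows k : size (alg_pows k) = k.
Proof. by elim: k => //= k IHk; rewrite size_rcons IHk. Qed.

Lemma nth_alg_pows k j : (j < k)%N -> nth 0%VS (alg_pows k) j = alg_pow j.+1.
Proof.
elim: k => // k IHk; rewrite ltnS leq_eqVlt => /predU1P[-> //|ltjk].
by rewrite /= nth_rcons size_alg_pows ltjk IHk.
Qed.

Lemma alg_pow1 : alg_pow 1 = fullv. Proof. by []. Qed.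

Lemma alg_powS k : (0 < k)%N ->
  alg_pow k.+1 = (\sum_(1 <= j < k.+1) prod_vs (alg_pow j) (alg_pow (k.+1 - j)))%VS.
Proof.
case: k => // k _; rewrite {1}/alg_pow [alg_pows _]/= -/(alg_pows k.+1).
rewrite nth_rcons size_alg_pows ltnn eqxx big_add1 /= big_mkord.
apply: eq_bigr => j _; rewrite !subSS -/(alg_pows k.+1).
rewrite !nth_alg_pows //; last by rewrite ltnS leq_subr.
by rewrite subSn // -ltnS.
Qed.

(* The type of A is s = [n_1, ..., n_r], with r = size s.                    *)
Definition has_type (s : seq nat) : Prop :=
  [/\ ann_ser A (size s) = fullv,
      forall r, (r < size s)%N -> ann_ser A r <> fullv
    & forall j, (j < size s)%N ->
        nth 0%N s j = (\dim (ann_ser A j.+1) - \dim (ann_ser A j))%N].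

End Nilpotent.

Section EvolutionBySquares.
Variables (F : fieldType) (n : nat) (sq : n.-tuple 'rV[F]_n).

(* The algebra on F^n for which the standard basis is natural, its k-th      *)
(* vector having square tnth sq k.                                           *)
Definition evol_mul (x y : 'rV[F]_n) : 'rV[F]_n :=
  \sum_k (x 0 k * y 0 k) *: tnth sq k.

Fact evol_mul_bilinear : bilinear_for *:%R *:%R evol_mul.
Proof.
split=> [y|x] a u v; rewrite /= /evol_mul scaler_sumr -big_split /=;
  apply: eq_bigr => k _; rewrite !mxE scalerA -scalerDl; congr (_ *: _).
  by rewrite mulrDl mulrA.
by rewrite mulrDr mulrCA.
Qed.
HB.instance Definition _ :=
  bilinear_isBilinear.Build F 'rV[F]_n 'rV[F]_n 'rV[F]_n _ _ evol_mul
    evol_mul_bilinear.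

Definition evol_alg : algebra F := @Algebra F 'rV[F]_n evol_mul.

Lemma evol_alg_mul (j k : 'I_n) :
  amul (delta_mx 0 j : evol_alg) (delta_mx 0 k) =
  if j == k then tnth sq k else 0.
Proof.
rewrite /= /evol_mul (bigD1 k) //= big1 ?addr0 => [|l nlk]; last first.
  by rewrite !mxE (negPf nlk) andbF mulr0 scale0r.
by rewrite !mxE !eqxx mulr1 eq_sym; case: eqP; rewrite ?scale1r ?scale0r.
Qed.

End EvolutionBySquares.

Section Families.
Variable F : fieldType.

Local Notation e2 := (delta_mx 0 (@Ordinal 5 1 isT)).
Local Notation e3 := (delta_mx 0 (@Ordinal 5 2 isT)).
Local Notation e4 := (delta_mx 0 (@Ordinal 5 3 isT)).
Local Notation e5 := (delta_mx 0 (@Ordinal 5 4 isT)).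

(* e1^2 = u, e2^2 = v, e3^2 = e4^2 = e5, e5^2 = 0.                           *)
Definition evol5 (u v : 'rV[F]_5) : algebra F :=
  evol_alg [tuple u; v; e5; e5; 0].

Definition alg1 := evol5 e2 e3.
Definition alg2 := evol5 (e2 + e4) e3.
Definition alg3 (beta : F) := evol5 (e2 + e3 + beta *: e4) e3.
Definition alg4 (i : F) := evol5 e2 (e3 + i *: e4).
Definition alg5 (i : F) := evol5 (e2 + e3) (e3 + i *: e4).
Definition alg6 (i : F) := evol5 (e2 + e3 + i *: e4) (e3 + i *: e4).
Definition alg7 (i : F) := evol5 (e2 + e3 - i *: e4) (e3 + i *: e4).

(* in_family i k A: A is literally a member of family (k).                   *)
Variant in_family (i : F) : nat -> algebra F -> Prop :=
  | InFamily1 : in_family i 1 alg1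
  | InFamily2 : in_family i 2 alg2
  | InFamily3 beta : in_family i 3 (alg3 beta)
  | InFamily4 : in_family i 4 (alg4 i)
  | InFamily5 : in_family i 5 (alg5 i)
  | InFamily6 : in_family i 6 (alg6 i)
  | InFamily7 : in_family i 7 (alg7 i).

End Families.

Arguments alg1 {F}.
Arguments alg2 {F}.

(* Main.v *)
From HB Require Import structures.
Require Import Defs.
From mathcomp Require Import all_boot all_order all_algebra.
From mathcomp Require Import ring.

(* Every term of the upper annihilating series is spanned by the vectors of  *)
(* the natural basis that it contains, so type [1,2,1,1] orders the basis as *)
(* e1; e2; e3, e4; e5 and makes the table of squares triangular.            *)
(* Rescaling and adding multiples of e5 gives e1^2 = e2 + a e3 + b e4,       *)
(* e2^2 = p e3 + r e4, e3^2 = e4^2 = e5. An isomorphism between two such     *)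
(* algebras preserves the flag of annihilators and orthogonality, and it     *)
(* acts on (a, b), (p, r) as a similarity R of the form x^2 + y^2 followed   *)
(* by the factors t^-2, t^-4, where t is its coefficient on e1. What is left *)
(* is to classify pairs of vectors with (p, r) nonzero: if (p, r) is         *)
(* anisotropic, rotate it to e3; otherwise use the isotropic basis           *)
(* e3 +- i e4, which R scales independently.                                 *)

(** The problem becomes one about the plane with the form x^2 + y^2. By [type1211_gen], [gen_iso]
    and [gen_isoP], the algebras correspond to pairs u = (a, b), v = (p, r) with v nonzero, up to u
    -> t^-2 R u, v -> t^-4 R v for nonzero t and similarities R. If v is anisotropic
    ([gen_anisotropic]), moving it to (1, 0) leaves t free to normalise one coordinate of u:
    families (1)-(3). If v is isotropic ([gen_isotropic]), the two isotropic directions scale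
    independently, so only the vanishing of the two coordinates of u matters: families (4)-(7).
    Conversely R multiplies the form by a nonzero constant, so the vanishing of v.v, u, u.v and, for
    isotropic v, u.u is invariant ([gen_inv_iso]); these conditions separate the families. In (3),
    keeping v = (1, 0) forces t^2 = 1 and R = diag(1, ±1), hence the sign of beta ([alg3_isoP]). *)

Set Implicit Arguments.
Unset Strict Implicit.
Unset Printing Implicit Defensive.

Import GRing.Theory.
Local Open Scope ring_scope.

(** * Isomorphisms and coordinates in a natural basis *)

Section Iso.
Variable F : fieldType.
Implicit Types A B C E : algebra F.

Lemma alg_isoI A B (f : A -> B) :
  linear f -> bijective f -> {morph f : x y / amul x y} -> alg_iso A B.
Proof.
move=> lin_f bij_f mul_f.
pose fL : {linear A -> B} := HB.pack f (GRing.isLinear.Build F A B _ f lin_f).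
by exists fL.
Qed.

Lemma alg_iso_trans B A C : alg_iso A B -> alg_iso B C -> alg_iso A C.
Proof.
case=> f [bij_f mul_f] [g [bij_g mul_g]].
apply: (@alg_isoI _ _ (g \o f)); last by move=> x y /=; rewrite mul_f mul_g.
- by move=> c x y /=; rewrite !linearP.
- exact: bij_comp.
Qed.

Lemma natural_basis_mul A n (e : n.-tuple A) x y : natural_basis e ->
  amul x y = \sum_k (coord e k x * coord e k y) *: amul (tnth e k) (tnth e k).
Proof.
case=> basis_e orth_e.
rewrite {1}(coord_basis basis_e (memvf x)) linear_sumlz.
apply: eq_bigr => k _; rewrite linearZl_LR -scalerA; congr (_ *: _).
rewrite {1}(coord_basis basis_e (memvf y)) linear_sumr.
rewrite (bigD1 k) //= linearZr_LR -!tnth_nth big1 ?addr0 // => l nlk.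
by rewrite linearZr_LR -tnth_nth orth_e 1?eq_sym ?scaler0.
Qed.

Lemma natural_basis_iso A n (e : n.-tuple A) (sq : n.-tuple 'rV[F]_n) :
    natural_basis e ->
    (forall k, amul (tnth e k) (tnth e k) = \sum_l tnth sq k 0 l *: tnth e l) ->
  alg_iso A (evol_alg sq).
Proof.
move=> nat_e sqE; have [basis_e _] := nat_e; have free_e := basis_free basis_e.
pose f (x : A) : evol_alg sq := \row_j coord e j x.
pose g (v : evol_alg sq) : A := \sum_j v 0 j *: e`_j.
have fK : cancel f g.
  move=> x; rewrite {2}(coord_basis basis_e (memvf x)).
  by apply: eq_bigr => j _; rewrite mxE.
have gK : cancel g f.
  by move=> v; apply/rowP=> j; rewrite mxE coord_sum_free.
apply: (@alg_isoI _ _ f).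
- by move=> c x y; apply/rowP=> j; rewrite !mxE linearP.
- by exists g.
- move=> x y; apply: (can_inj gK); rewrite fK (natural_basis_mul _ _ nat_e).
  rewrite /g /= /evol_mul.
  transitivity (\sum_k \sum_l
     (coord e k x * coord e k y * tnth sq k 0 l) *: e`_l).
    apply: eq_bigr => k _; rewrite sqE scaler_sumr.
    by apply: eq_bigr => l _; rewrite scalerA -tnth_nth.
  rewrite exchange_big; apply: eq_bigr => l _.
  rewrite summxE scaler_suml; apply: eq_bigr => k _.
  by rewrite !mxE.
Qed.

End Iso.

(** * Triangular tables of squares and their isomorphisms *)

Section Tri.
Variable F : fieldType.

Definition row5 (x1 x2 x3 x4 x5 : F) : 'rV[F]_5 :=
  \row_j [:: x1; x2; x3; x4; x5]`_j.

Lemma row5E (x : 'rV[F]_5) : exists x1 x2 x3 x4 x5, x = row5 x1 x2 x3 x4 x5.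
Proof.
exists (x 0 (inord 0)), (x 0 (inord 1)), (x 0 (inord 2)), (x 0 (inord 3)),
  (x 0 (inord 4)).
apply/rowP=> -[[|[|[|[|[|//]]]]] lt5]; rewrite mxE /=;
  by congr (x _ _); apply: val_inj; rewrite /= inordK.
Qed.

Lemma row5_inj x1 x2 x3 x4 x5 y1 y2 y3 y4 y5 :
  row5 x1 x2 x3 x4 x5 = row5 y1 y2 y3 y4 y5 ->
  [/\ x1 = y1, x2 = y2, x3 = y3, x4 = y4 & x5 = y5].
Proof.
move=> /rowP eqxy; split; [move: (eqxy (inord 0)) | move: (eqxy (inord 1))
 | move: (eqxy (inord 2)) | move: (eqxy (inord 3)) | move: (eqxy (inord 4))];
  by rewrite !mxE !inordK.
Qed.

Lemma row5D x1 x2 x3 x4 x5 y1 y2 y3 y4 y5 :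
  row5 x1 x2 x3 x4 x5 + row5 y1 y2 y3 y4 y5 =
  row5 (x1 + y1) (x2 + y2) (x3 + y3) (x4 + y4) (x5 + y5).
Proof. by apply/rowP=> -[[|[|[|[|[|//]]]]] lt5]; rewrite !mxE. Qed.

Lemma row5Z c x1 x2 x3 x4 x5 :
  c *: row5 x1 x2 x3 x4 x5 =
  row5 (c * x1) (c * x2) (c * x3) (c * x4) (c * x5).
Proof. by apply/rowP=> -[[|[|[|[|[|//]]]]] lt5]; rewrite !mxE. Qed.

Definition tri (u2 u3 u4 u5 v3 v4 v5 a b : F) : algebra F :=
  evol_alg [tuple row5 0 u2 u3 u4 u5; row5 0 0 v3 v4 v5;
                  row5 0 0 0 0 a; row5 0 0 0 0 b; 0].

(* e1^2 = e2 + a e3 + b e4, e2^2 = p e3 + r e4, e3^2 = e4^2 = e5, e5^2 = 0.  *)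
Definition gen (a b p r : F) : algebra F := tri 1 a b 0 p r 0 1 1.

Lemma tri_mul u2 u3 u4 u5 v3 v4 v5 a b x1 x2 x3 x4 x5 y1 y2 y3 y4 y5 :
  amul (row5 x1 x2 x3 x4 x5 : tri u2 u3 u4 u5 v3 v4 v5 a b)
    (row5 y1 y2 y3 y4 y5) =
  row5 0 (x1 * y1 * u2) (x1 * y1 * u3 + x2 * y2 * v3)
    (x1 * y1 * u4 + x2 * y2 * v4)
    (x1 * y1 * u5 + x2 * y2 * v5 + x3 * y3 * a + x4 * y4 * b).
Proof.
rewrite /= /evol_mul !big_ord_recl big_ord0 !(tnth_nth 0) /= !mxE /=.
rewrite scaler0 !addr0 !row5Z !row5D.
by congr row5; ring.
Qed.

(* The isomorphism maps e1, ..., e5 to t e1, m e2 + d e5,                     *)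
(* A e3 + B e4 + g e5, C e3 + D e4 + h e5 and c e5.                          *)
Lemma tri_iso u2 u3 u4 u5 v3 v4 v5 a b (u3' u4' v3' v4' : F)
    t m A B C D d g h c :
    t != 0 -> m != 0 -> A * D - B * C != 0 -> c != 0 ->
    m * u2 = t ^+ 2 -> A * u3 + C * u4 = t ^+ 2 * u3' ->
    B * u3 + D * u4 = t ^+ 2 * u4' -> d * u2 + g * u3 + h * u4 + c * u5 = 0 ->
    A * v3 + C * v4 = m ^+ 2 * v3' -> B * v3 + D * v4 = m ^+ 2 * v4' ->
    g * v3 + h * v4 + c * v5 = 0 ->
    A ^+ 2 + B ^+ 2 = c * a -> C ^+ 2 + D ^+ 2 = c * b -> A * C + B * D = 0 ->
  alg_iso (tri u2 u3 u4 u5 v3 v4 v5 a b) (gen u3' u4' v3' v4').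
Proof.
move=> t0 m0 det0 c0 Eu2 Eu3 Eu4 Eu5 Ev3 Ev4 Ev5 Eaa Ebb Eab.
pose co k (x : 'rV[F]_5) := x 0 (inord k).
pose f (x : 'rV[F]_5) := row5 (t * co 0 x) (m * co 1 x)
  (A * co 2 x + C * co 3 x) (B * co 2 x + D * co 3 x)
  (d * co 1 x + g * co 2 x + h * co 3 x + c * co 4 x).
(* The inverse: Cramer's rule on the block of e3, e4, then back substitution for e5. *)
pose g' (x : 'rV[F]_5) :=
  let x3 := (D * co 2 x - C * co 3 x) / (A * D - B * C) in
  let x4 := (A * co 3 x - B * co 2 x) / (A * D - B * C) in
  row5 (co 0 x / t) (co 1 x / m) x3 x4
    ((co 4 x - d * (co 1 x / m) - g * x3 - h * x4) / c).
have co5 x1 x2 x3 x4 x5 : (co 0 (row5 x1 x2 x3 x4 x5) = x1) *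
  (co 1 (row5 x1 x2 x3 x4 x5) = x2) * (co 2 (row5 x1 x2 x3 x4 x5) = x3) *
  (co 3 (row5 x1 x2 x3 x4 x5) = x4) * (co 4 (row5 x1 x2 x3 x4 x5) = x5).
  by rewrite /co !mxE !inordK.
apply: (@alg_isoI _ (tri u2 u3 u4 u5 v3 v4 v5 a b) (gen u3' u4' v3' v4') f).
- move=> z x y.
  have [x1 [x2 [x3 [x4 [x5 ->]]]]] := row5E x.
  have [y1 [y2 [y3 [y4 [y5 ->]]]]] := row5E y.
  by rewrite /f !(row5Z, row5D, co5); congr row5; ring.
- exists g' => x; have [x1 [x2 [x3 [x4 [x5 ->]]]]] := row5E x.
    by rewrite /f /g' !co5; congr row5; field; do ?[apply/andP; split].
  by rewrite /f /g' !co5; congr row5; field; do ?[apply/andP; split].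
move=> x y.
have [x1 [x2 [x3 [x4 [x5 ->]]]]] := row5E x.
have [y1 [y2 [y3 [y4 [y5 ->]]]]] := row5E y.
rewrite tri_mul /f /gen tri_mul !co5; congr row5.
- by ring.
- by rewrite mulrCA Eu2; ring.
- transitivity (x1 * y1 * (A * u3 + C * u4) + x2 * y2 * (A * v3 + C * v4)).
    by ring.
  by rewrite Eu3 Ev3; ring.
- transitivity (x1 * y1 * (B * u3 + D * u4) + x2 * y2 * (B * v3 + D * v4)).
    by ring.
  by rewrite Eu4 Ev4; ring.
(* In the e5 coordinate the mixed terms in x3 y4 and x4 y3 carry the factor A C + B D = 0. *)
transitivity (x1 * y1 * (d * u2 + g * u3 + h * u4 + c * u5)
  + x2 * y2 * (g * v3 + h * v4 + c * v5) + x3 * y3 * (c * a) + x4 * y4 * (c * b)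
  + (x3 * y4 + x4 * y3) * 0).
  by ring.
by rewrite Eu5 Ev5 -Eaa -Ebb -{3}Eab; ring.
Qed.

(* Lagrange's identity: the square of this determinant is c ^+ 2. *)
Lemma similarity_det_neq0 (A B C D c : F) : c != 0 ->
  A ^+ 2 + B ^+ 2 = c -> C ^+ 2 + D ^+ 2 = c -> A * C + B * D = 0 ->
  A * D - B * C != 0.
Proof.
move=> c0 AB CD ABCD; rewrite -sqrf_eq0.
suff -> : (A * D - B * C) ^+ 2 = c ^+ 2 by rewrite sqrf_eq0.
transitivity ((A ^+ 2 + B ^+ 2) * (C ^+ 2 + D ^+ 2) - (A * C + B * D) ^+ 2).
  by ring.
by rewrite AB CD ABCD; ring.
Qed.

Lemma gen_mul (a b p r x1 x2 x3 x4 x5 y1 y2 y3 y4 y5 : F) :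
  amul (row5 x1 x2 x3 x4 x5 : gen a b p r) (row5 y1 y2 y3 y4 y5) =
  row5 0 (x1 * y1) (x1 * y1 * a + x2 * y2 * p) (x1 * y1 * b + x2 * y2 * r)
    (x3 * y3 + x4 * y4).
Proof. by rewrite /gen tri_mul; congr row5; ring. Qed.

(** Scaling e1 by t forces the factor t^2 on e2, whence t^2 on (a, b) and t^4 on (p, r); the
    similarity acts on the plane of e3, e4 and scales e5 by c. *)
Lemma gen_iso (a b p r a' b' p' r' t A B C D c : F) :
    t != 0 -> c != 0 -> A ^+ 2 + B ^+ 2 = c -> C ^+ 2 + D ^+ 2 = c ->
    A * C + B * D = 0 ->
    t ^+ 2 * a' = A * a + C * b -> t ^+ 2 * b' = B * a + D * b ->
    t ^+ 4 * p' = A * p + C * r -> t ^+ 4 * r' = B * p + D * r ->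
  alg_iso (gen a b p r) (gen a' b' p' r').
Proof.
move=> t0 c0 AB CD ABCD Ea Eb Ep Er.
have det0 : A * D - B * C != 0 by apply: (similarity_det_neq0 c0).
apply: (tri_iso (t := t) (m := t ^+ 2) (A := A) (B := B) (C := C) (D := D)
  (d := 0) (g := 0) (h := 0) (c := c));
  rewrite ?mulr1 ?expf_neq0 //; do ?by [rewrite -?exprM; symmetry | ring].
Qed.

(** Converse of [gen_iso]. Write Pjk for the coordinates of the image of ej. Preservation of
    annihilators makes this matrix block triangular, and orthogonality then kills P12, P23 and P24;
    comparing squares gives the similarity. *)
Lemma gen_isoP (a b p r a' b' p' r' : F) :
    (p' != 0) || (r' != 0) ->
    alg_iso (gen a b p r) (gen a' b' p' r') ->
  exists t A B C D c : F,
    [/\ [/\ t != 0, c != 0, A ^+ 2 + B ^+ 2 = c,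
            C ^+ 2 + D ^+ 2 = c & A * C + B * D = 0],
        t ^+ 2 * a' = A * a + C * b, t ^+ 2 * b' = B * a + D * b,
        t ^+ 4 * p' = A * p + C * r & t ^+ 4 * r' = B * p + D * r].
Proof.
move=> v'0 [f [[g fK gK] fM]].
have v'_eq0 x : x * p' = 0 -> x * r' = 0 -> x = 0.
  move=> /eqP + /eqP; rewrite !mulf_eq0.
  by case: eqP => //= _ p0 r0; move: v'0; rewrite p0 r0.
have [P11 [P12 [P13 [P14 [P15 E1]]]]] := row5E (f (row5 1 0 0 0 0)).
have [P21 [P22 [P23 [P24 [P25 E2]]]]] := row5E (f (row5 0 1 0 0 0)).
have [P31 [P32 [P33 [P34 [P35 E3]]]]] := row5E (f (row5 0 0 1 0 0)).
have [P41 [P42 [P43 [P44 [P45 E4]]]]] := row5E (f (row5 0 0 0 1 0)).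
have [P51 [P52 [P53 [P54 [P55 E5]]]]] := row5E (f (row5 0 0 0 0 1)).
have fE x1 x2 x3 x4 x5 : f (row5 x1 x2 x3 x4 x5) =
    row5 (x1 * P11 + x2 * P21 + x3 * P31 + x4 * P41 + x5 * P51)
         (x1 * P12 + x2 * P22 + x3 * P32 + x4 * P42 + x5 * P52)
         (x1 * P13 + x2 * P23 + x3 * P33 + x4 * P43 + x5 * P53)
         (x1 * P14 + x2 * P24 + x3 * P34 + x4 * P44 + x5 * P54)
         (x1 * P15 + x2 * P25 + x3 * P35 + x4 * P45 + x5 * P55).
  have -> : row5 x1 x2 x3 x4 x5 = x1 *: row5 1 0 0 0 0 + x2 *: row5 0 1 0 0 0
      + x3 *: row5 0 0 1 0 0 + x4 *: row5 0 0 0 1 0 + x5 *: row5 0 0 0 0 1.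
    by rewrite !row5Z !row5D; congr row5; ring.
  by rewrite !linearD !linearZ_LR E1 E2 E3 E4 E5 !row5Z !row5D.
clear E1 E2 E3 E4 E5.
(* As f is onto, this describes every product with an image; no y5 appears because e5 annihilates
   everything. *)
have img x1 x2 x3 x4 x5 z : exists y1 y2 y3 y4,
    amul (f (row5 x1 x2 x3 x4 x5)) z = f (row5 0 (x1 * y1)
      (x1 * y1 * a + x2 * y2 * p) (x1 * y1 * b + x2 * y2 * r)
      (x3 * y3 + x4 * y4)).
  have [y1 [y2 [y3 [y4 [y5 Ey]]]]] := row5E (g z).
  by exists y1, y2, y3, y4; rewrite -(gen_mul _ _ _ _ _ _ _ _ x5 _ _ _ _ y5) -Ey fM gK.
have {}fM x1 x2 x3 x4 x5 y1 y2 y3 y4 y5 :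
    amul (f (row5 x1 x2 x3 x4 x5)) (f (row5 y1 y2 y3 y4 y5)) =
    f (row5 0 (x1 * y1) (x1 * y1 * a + x2 * y2 * p) (x1 * y1 * b + x2 * y2 * r)
      (x3 * y3 + x4 * y4)).
  by rewrite -fM gen_mul.
have simpF := (mul0r, mulr0, add0r, addr0, mul1r, mulr1).
have [P51_0 P52_0 P53_0 P54_0] : [/\ P51 = 0, P52 = 0, P53 = 0 & P54 = 0].
  have P5z z : amul (f (row5 0 0 0 0 1)) z = f (row5 0 0 0 0 0).
    by have [y1 [y2 [y3 [y4 ->]]]] := img 0 0 0 0 1 z; rewrite !simpF.
  have := P5z (row5 1 0 0 0 0); rewrite !fE gen_mul !simpF => /row5_inj[_ -> _ _ _].
  have := P5z (row5 0 1 0 0 0); rewrite !fE gen_mul !simpF => /row5_inj[_ _ p0 r0 _].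
  have := P5z (row5 0 0 1 0 0); rewrite !fE gen_mul !simpF => /row5_inj[_ _ _ _ ->].
  have := P5z (row5 0 0 0 1 0); rewrite !fE gen_mul !simpF => /row5_inj[_ _ _ _ ->].
  by split=> //; apply: v'_eq0.
(* Products with e3 lie on the line of e5, which f preserves; testing against e1 and e2 kills the
   first two coordinates of the image. *)
have [P31_0 P32_0] : P31 = 0 /\ P32 = 0.
  have P3z z : exists k, amul (f (row5 0 0 1 0 0)) z = row5 0 0 0 0 k.
    have [y1 [y2 [y3 [y4 ->]]]] := img 0 0 1 0 0 z; exists (y3 * P55).
    by rewrite fE P51_0 P52_0 P53_0 P54_0 !simpF.
  have [?] := P3z (row5 1 0 0 0 0); rewrite !fE gen_mul !simpF => /row5_inj[_ -> _ _ _].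
  have [?] := P3z (row5 0 1 0 0 0); rewrite !fE gen_mul !simpF => /row5_inj[_ _ p0 r0 _].
  by split=> //; apply: v'_eq0.
have [P41_0 P42_0] : P41 = 0 /\ P42 = 0.
  have P4z z : exists k, amul (f (row5 0 0 0 1 0)) z = row5 0 0 0 0 k.
    have [y1 [y2 [y3 [y4 ->]]]] := img 0 0 0 1 0 z; exists (y4 * P55).
    by rewrite fE P51_0 P52_0 P53_0 P54_0 !simpF.
  have [?] := P4z (row5 1 0 0 0 0); rewrite !fE gen_mul !simpF => /row5_inj[_ -> _ _ _].
  have [?] := P4z (row5 0 1 0 0 0); rewrite !fE gen_mul !simpF => /row5_inj[_ _ p0 r0 _].
  by split=> //; apply: v'_eq0.
have P21_0 : P21 = 0.
  have [y1 [y2 [y3 [y4]]]] := img 0 1 0 0 0 (row5 1 0 0 0 0).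
  rewrite !fE gen_mul P31_0 P32_0 P41_0 P42_0 P51_0 P52_0 !simpF.
  by move/row5_inj=> [_ -> _ _ _].
(* Only the image of e1 can have a component along e1, and f is onto. *)
have P11_neq0 : P11 != 0.
  have [x1 [x2 [x3 [x4 [x5]]]]] := row5E (g (row5 1 0 0 0 0)).
  move/(congr1 f); rewrite gK fE P21_0 P31_0 P41_0 P51_0 !simpF => /row5_inj[E1 _ _ _ _].
  by apply: contra_eq_neq E1 => ->; rewrite mulr0 oner_neq0.
have P55_neq0 : P55 != 0.
  apply/eqP=> P55_0.
  have : row5 0 0 0 0 1 = row5 0 0 0 0 0 :> gen a b p r.
    by apply: (can_inj fK); rewrite !fE P51_0 P52_0 P53_0 P54_0 P55_0 !simpF.
  by case/row5_inj=> _ _ _ _ /eqP; rewrite oner_eq0.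
move: fE fM; rewrite P21_0 P31_0 P32_0 P41_0 P42_0 P51_0 P52_0 P53_0 P54_0 => fE fM.
have := fM 1 0 0 0 0 1 0 0 0 0; rewrite !fE gen_mul !simpF => /row5_inj[_ E22 E13 E14 _].
have := fM 1 0 0 0 0 0 1 0 0 0; rewrite !fE gen_mul !simpF => /row5_inj[_ _ E123 E124 _].
have P22_neq0 : P22 != 0 by rewrite -E22 mulf_neq0.
(* The images of e1 and e2 are orthogonal, and their product has e3 and e4 coordinates P12 P22 p'
   and P12 P22 r'. *)
have P12_0 : P12 = 0 by apply/(mulIf P22_neq0)/eqP; rewrite mul0r; apply/eqP/v'_eq0.
have := fM 0 0 1 0 0 0 0 1 0 0; rewrite !fE gen_mul !simpF => /row5_inj[_ _ _ _ E33].
have := fM 0 0 0 1 0 0 0 0 1 0; rewrite !fE gen_mul !simpF => /row5_inj[_ _ _ _ E44].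
have := fM 0 0 1 0 0 0 0 0 1 0; rewrite !fE gen_mul !simpF => /row5_inj[_ _ _ _ E34].
have := fM 0 1 0 0 0 0 1 0 0 0; rewrite !fE gen_mul !simpF => /row5_inj[_ _ E23 E24 _].
have := fM 0 1 0 0 0 0 0 1 0 0; rewrite !fE gen_mul !simpF => /row5_inj[_ _ _ _ O23].
have := fM 0 1 0 0 0 0 0 0 1 0; rewrite !fE gen_mul !simpF => /row5_inj[_ _ _ _ O24].
have det_neq0 : P33 * P44 - P34 * P43 != 0.
  exact: (similarity_det_neq0 P55_neq0).
(* (P23, P24) is orthogonal to the independent vectors (P33, P34) and (P43, P44), hence zero. *)
have P23_0 : P23 = 0.
  apply/(mulIf det_neq0); rewrite mul0r.
  transitivity (P44 * (P23 * P33 + P24 * P34) - P34 * (P23 * P43 + P24 * P44)).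
    by ring.
  by rewrite O23 O24 !mulr0 subr0.
have P24_0 : P24 = 0.
  apply/(mulIf det_neq0); rewrite mul0r.
  transitivity (P33 * (P23 * P43 + P24 * P44) - P43 * (P23 * P33 + P24 * P34)).
    by ring.
  by rewrite O23 O24 !mulr0 subr0.
exists P11, P33, P34, P43, P44, P55; move: E13 E14 E23 E24.
rewrite P12_0 P23_0 P24_0 !simpF -E22 => E13 E14 E23 E24.
split; first by split; rewrite // expr2.
- by rewrite expr2 E13; ring.
- by rewrite expr2 E14; ring.
- by rewrite [P11 ^+ 4](_ : _ = P11 * P11 * (P11 * P11)) ?E23; ring.
- by rewrite [P11 ^+ 4](_ : _ = P11 * P11 * (P11 * P11)) ?E24; ring.
Qed.
End Tri.

(** * The annihilating series in a natural basis *)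

Section Layers.
Variables (F : fieldType) (E : algebra F) (n : nat) (e : n.-tuple E).
Hypothesis nat_e : natural_basis e.
Let basis_e : basis_of {:E} e. Proof. by case: nat_e. Qed.
Let free_e : free e. Proof. exact: basis_free basis_e. Qed.

Lemma natural_basis_mulr x k :
  amul x (tnth e k) = coord e k x *: amul (tnth e k) (tnth e k) /\
  amul (tnth e k) x = coord e k x *: amul (tnth e k) (tnth e k).
Proof.
have ek l : coord e l (tnth e k) = (k == l)%:R.
  by rewrite (tnth_nth 0) coord_free.
split; rewrite (natural_basis_mul _ _ nat_e) (bigD1 k) //= ek eqxx ?mulr1 ?mul1r;
  rewrite big1 ?addr0 // => l nlk;
  by rewrite ek eq_sym (negPf nlk) ?mulr0 ?mul0r scale0r.
Qed.

Lemma natural_basis_ann_serS j k :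
  (tnth e k \in ann_ser E j.+1) = (amul (tnth e k) (tnth e k) \in ann_ser E j).
Proof.
apply/idP/idP=> [/ann_serS/(_ (tnth e k))[] // | ek2].
by apply/ann_serS=> y; have [-> ->] := natural_basis_mulr y k; rewrite rpredZ.
Qed.

(** If x in ann^(j+1) has a nonzero coordinate on ek, then x ek is a nonzero multiple of ek^2, so
    ek^2 lies in ann^j and ek itself lies in ann^(j+1). *)
Lemma ann_ser_span j : ann_ser E j = <<[seq x <- e | x \in ann_ser E j]>>%VS.
Proof.
apply/eqP; rewrite eqEsubv; apply/andP; split; last first.
  by apply/span_subvP=> x; rewrite mem_filter => /andP[].
case: j => [|j]; first exact: sub0v.
apply/subvP=> x xN; rewrite (coord_basis basis_e (memvf x)).
apply: rpred_sum => k _; rewrite -tnth_nth.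
have [-> | ck] := eqVneq (coord e k x) 0; first by rewrite scale0r mem0v.
rewrite rpredZ // memv_span // mem_filter mem_tnth andbT natural_basis_ann_serS.
have /ann_serS/(_ (tnth e k))[] := xN; have [-> _] := natural_basis_mulr x k.
by rewrite rpredZeq (negPf ck).
Qed.

Lemma dim_ann_ser j : \dim (ann_ser E j) = count (mem (ann_ser E j)) e.
Proof.
by rewrite {1}ann_ser_span -size_filter; apply/eqP/filter_free.
Qed.
End Layers.

Lemma ann_ser_subS (F : fieldType) (E : algebra F) j :
  (ann_ser E j <= ann_ser E j.+1)%VS.
Proof.
elim: j => [|j IHj]; first exact: sub0v.
apply/subvP=> x /ann_serS xN; apply/ann_serS=> y.
by have [xy yx] := xN y; split; apply: (subvP IHj).
Qed.

Lemma mem_span_cons (F : fieldType) (V : vectType F) (x y : V) (s : seq V) :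
  x \in <<y :: s>>%VS -> exists c, exists2 x', x' \in <<s>>%VS & x = c *: y + x'.
Proof.
by rewrite span_cons => /memv_addP[_ /vlineP[c ->] [x' x's ->]]; exists c, x'.
Qed.

(** * Ordering the basis by the type *)

Section Order.
Variables (F : fieldType) (E : algebra F).

(** The basis vectors are grouped by the step of the series at which they appear. The square of a
    vector lies one step lower, and no lower than that: the first fact makes the table triangular,
    the second makes its leading coefficients nonzero. *)
Lemma type1211_natural_basis :
    evolution_algebra E -> has_type E [:: 1; 2; 1; 1]%N ->
  exists e1 e2 e3 e4 e5 : E, exists u2 u3 u4 u5 v3 v4 v5 a b : F,
    [/\ natural_basis [tuple e1; e2; e3; e4; e5],
        [/\ u2 != 0, (v3 != 0) || (v4 != 0), a != 0 & b != 0],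
        amul e1 e1 = u2 *: e2 + (u3 *: e3 + (u4 *: e4 + u5 *: e5)),
        amul e2 e2 = v3 *: e3 + (v4 *: e4 + v5 *: e5)
      & [/\ amul e3 e3 = a *: e5, amul e4 e4 = b *: e5 & amul e5 e5 = 0]].
Proof.
move=> [n [e nat_e]] [N4 _ dimN].
pose N := ann_ser E; pose S j := [seq x <- e | x \in N j].
(* Indices count from the bottom: [layer 0] will be e5 and [layer 3] will be e1. *)
pose layer j := [seq x <- e | (x \notin N j) && (x \in N j.+1)].
have spanS j : N j = <<S j>>%VS by apply: ann_ser_span.
have permS j : perm_eq (S j.+1) (layer j ++ S j).
  have SE : [seq x <- S j.+1 | x \in N j] = S j.
    rewrite /S -filter_predI; apply: eq_filter => x /=.
    by case xN: (x \in N j) => //; rewrite (subvP (ann_ser_subS E j)).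
  have LE : layer j = [seq x <- S j.+1 | predC (mem (N j)) x].
    by rewrite /S -filter_predI; apply: eq_filter.
  by rewrite -SE LE perm_sym perm_catC; apply/permEl/perm_filterC.
have size_layer j : (j < 4)%N -> size (layer j) = nth 0%N [:: 1; 2; 1; 1]%N j.
  move=> ltj; rewrite dimN // !(dim_ann_ser nat_e) -!size_filter.
  by rewrite (perm_size (permS j)) size_cat addnK.
have layerP j x : x \in layer j ->
    amul x x \in N j /\ forall k, j = k.+1 -> amul x x \notin N k.
  rewrite mem_filter => /andP[/andP[xNj xNj1] /tnthP[l xE]].
  split=> [|k jE]; first by rewrite xE -(natural_basis_ann_serS nat_e) -xE.
  by rewrite xE -(natural_basis_ann_serS nat_e) -xE -jE.
have S0 : S 0 = [::].
  by apply/nilP; rewrite /nilp size_filter -(dim_ann_ser nat_e) dimv0.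
have [e5 L0] : exists e5, layer 0 = [:: e5].
  by case: (layer 0) (size_layer 0 isT) => [|e5 [|]] //; exists e5.
have [e3 [e4 L1]] : exists e3 e4, layer 1 = [:: e3; e4].
  by case: (layer 1) (size_layer 1%N isT) => [|e3 [|e4 [|]]] //; exists e3, e4.
have [e2 L2] : exists e2, layer 2 = [:: e2].
  by case: (layer 2) (size_layer 2%N isT) => [|e2 [|]] //; exists e2.
have [e1 L3] : exists e1, layer 3 = [:: e1].
  by case: (layer 3) (size_layer 3%N isT) => [|e1 [|]] //; exists e1.
have S1 : perm_eq (S 1) [:: e5] by rewrite (permPl (permS 0)) L0 S0.
have S2 : perm_eq (S 2) [:: e3; e4; e5] by rewrite (permPl (permS 1)) L1 !perm_cons.
have S3 : perm_eq (S 3) [:: e2; e3; e4; e5] by rewrite (permPl (permS 2)) L2 perm_cons.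
have S4 : perm_eq (S 4) [:: e1; e2; e3; e4; e5].
  by rewrite (permPl (permS 3)) L3 perm_cons.
have N1 : N 1 = <<[:: e5]>>%VS by rewrite spanS; apply/eq_span/perm_mem.
have N2 : N 2 = <<[:: e3; e4; e5]>>%VS by rewrite spanS; apply/eq_span/perm_mem.
have N3 : N 3 = <<[:: e2; e3; e4; e5]>>%VS by rewrite spanS; apply/eq_span/perm_mem.
have e_perm : perm_eq e [:: e1; e2; e3; e4; e5].
  rewrite -(permPr S4) /S (eq_filter (a2 := predT)) ?filter_predT // => x.
  by rewrite /N N4 memvf.
have [e1N3 e1N2] := layerP 3%N e1 ltac:(by rewrite L3 mem_head).
have [e2N2 e2N1] := layerP 2%N e2 ltac:(by rewrite L2 mem_head).
have [e3N1 e3N0] := layerP 1%N e3 ltac:(by rewrite L1 mem_head).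
have [e4N1 e4N0] := layerP 1%N e4 ltac:(by rewrite L1 !inE eqxx orbT).
have [e5N0 _] := layerP 0 e5 ltac:(by rewrite L0 mem_head).
move/(_ _ erefl): e1N2; move/(_ _ erefl): e2N1.
move/(_ _ erefl): e3N0; move/(_ _ erefl): e4N0; rewrite !memv0.
move: e1N3 e2N2 e3N1 e4N1 e5N0; rewrite N1 N2 N3 memv0.
move=> /mem_span_cons[u2 [x1 x1N e11]] /mem_span_cons[v3 [x2 x2N e22]].
have [u3 [x3 x3N x1E]] := mem_span_cons x1N.
have [u4 [x4 x4N x3E]] := mem_span_cons x3N.
have [v4 [x5 x5N x2E]] := mem_span_cons x2N.
move: x4N x5N; rewrite span_seq1 => /vlineP[u5 x4E] /vlineP[v5 x5E].
rewrite {x1N}x1E {x3N}x3E {}x4E in e11; rewrite {x2N}x2E {}x5E in e22.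
move=> /vlineP[a e33] /vlineP[b e44] /eqP e55.
rewrite e11 e22 e33 e44 => b0 a0 v0 u0.
exists e1, e2, e3, e4, e5, u2, u3, u4, u5, v3, v4, v5, a, b; split=> //.
- have [basis_e orth_e] := nat_e; have basis_e' := basis_e.
  rewrite (perm_basis _ e_perm) in basis_e'.
  (* By freeness, distinct positions in the new order hold distinct vectors, hence come from
     distinct positions of [e], where orthogonality is known. *)
  split=> // j k njk; set x := tnth _ j; set y := tnth _ k.
  have /tnthP[j' xE] : x \in e by rewrite (perm_mem e_perm) mem_tnth.
  have /tnthP[k' yE] : y \in e by rewrite (perm_mem e_perm) mem_tnth.
  rewrite xE yE orth_e //; apply: contraNneq njk => jk'.
  have /tuple_uniqP e_inj := free_uniq (basis_free basis_e').
  by apply/eqP/e_inj; rewrite -/x -/y xE yE jk'.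
- split.
  + apply: contraNneq u0 => ->; rewrite scale0r add0r.
    by do ![apply: rpredD | apply: rpredZ]; rewrite memv_span ?inE ?eqxx ?orbT.
  + apply: contraNT v0; rewrite negb_or !negbK => /andP[/eqP-> /eqP->].
    by rewrite !scale0r !add0r rpredZ ?memv_line.
  + by apply: contraNneq a0 => ->; rewrite scale0r.
  + by apply: contraNneq b0 => ->; rewrite scale0r.
Qed.
End Order.

(** * Reduction to [gen] over an algebraically closed field *)

Section Classification.
Variable F : closedFieldType.

Lemma closed_sqrt (x : F) : x != 0 -> exists2 y, y != 0 & y ^+ 2 = x.
Proof.
move=> x0; have [y Ey] :=
  solve_monicpoly (fun k => if k is 0 then x else 0) (isT : (0 < 2)%N).
rewrite !big_ord_recl big_ord0 /= mul0r !addr0 mulr1 in Ey.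
by exists y => //; rewrite -sqrf_eq0 Ey.
Qed.

Lemma type1211_gen (E : algebra F) :
    evolution_algebra E -> has_type E [:: 1; 2; 1; 1]%N ->
  exists a b p r : F, (p != 0) || (r != 0) /\ alg_iso E (gen a b p r).
Proof.
move=> evE /(type1211_natural_basis evE).
move=> [e1 [e2 [e3 [e4 [e5 [u2 [u3 [u4 [u5 [v3 [v4 [v5 [a [b]]]]]]]]]]]]]].
case=> nat_e [u20 v0 a0 b0] e11 e22 [e33 e44 e55].
have E_tri : alg_iso E (tri u2 u3 u4 u5 v3 v4 v5 a b).
  apply: (natural_basis_iso nat_e) => k; rewrite !big_ord_recl big_ord0 !(tnth_nth 0) /=.
  case: k => -[|[|[|[|[|//]]]]] lt5 /=;
    by rewrite ?(e11, e22, e33, e44, e55) !mxE /= ?(scale0r, add0r, addr0).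
have [s s0 s2] := closed_sqrt a0; have [s' s'0 s'2] := closed_sqrt b0.
(* Multiples of e5 to add to the images of e3 and e4, so that e2^2 loses its e5 component. *)
have [g [h gh]] : exists g h, g * v3 + h * v4 + v5 = 0.
  case/orP: v0 => v0; [exists (- v5 / v3), 0 | exists 0, (- v5 / v4)].
    by rewrite mul0r addr0 divfK ?addNr.
  by rewrite mul0r add0r divfK ?addNr.
exists (s * u3), (s' * u4), (u2 ^+ 2 * s * v3), (u2 ^+ 2 * s' * v4); split.
  by rewrite !mulf_eq0 !(negPf u20) (negPf s0) (negPf s'0).
apply: alg_iso_trans E_tri _.
(* The scaling [m] makes the e2 coefficient of e1^2 equal to 1, [s] and [s'] normalise e3^2 and
   e4^2, and [d] removes the e5 component of e1^2. *)
apply: (tri_iso (t := 1) (m := u2^-1) (A := s) (B := 0) (C := 0) (D := s')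
  (d := - (g * u3 + h * u4 + u5) / u2) (g := g) (h := h) (c := 1));
  rewrite ?oner_neq0 ?invr_eq0 //; do ?by [rewrite ?s2 ?s'2; ring | field].
  by rewrite mulr0 subr0 mulf_neq0.
by rewrite mul1r.
Qed.

Variable i : F.
Hypothesis i2 : i ^+ 2 = -1.
Hypothesis charF : 2%N \notin [pchar F].

Let two0 : 2 != 0 :> F.
Proof. by move: charF; rewrite inE. Qed.

Let i0 : i != 0.
Proof. by rewrite -sqrf_eq0 i2 oppr_eq0 oner_eq0. Qed.

Ltac family_gen := rewrite /evol5 /gen /tri; congr evol_alg; apply: val_inj => /=;
 congr [:: _; _; _; _; _]; apply/rowP=> -[[|[|[|[|[|//]]]]] lt5]; rewrite !mxE /=;
 by rewrite ?(mulr0, mulr1, addr0, add0r, oppr0, subr0).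

(** * Normal forms of the pairs (a, b), (p, r) *)

Lemma family1E : @alg1 F = gen 0 0 1 0. Proof. family_gen. Qed.
Lemma family2E : @alg2 F = gen 0 1 1 0. Proof. family_gen. Qed.
Lemma family3E beta : @alg3 F beta = gen 1 beta 1 0. Proof. family_gen. Qed.
Lemma family4E : @alg4 F i = gen 0 0 1 i. Proof. family_gen. Qed.
Lemma family5E : @alg5 F i = gen 1 0 1 i. Proof. family_gen. Qed.
Lemma family6E : @alg6 F i = gen 1 i 1 i. Proof. family_gen. Qed.
Lemma family7E : @alg7 F i = gen 1 (- i) 1 i. Proof. family_gen. Qed.

Lemma gen_anisotropic (a b p r : F) : p ^+ 2 + r ^+ 2 != 0 ->
  exists k B, in_family i k B /\ alg_iso (gen a b p r) B.
Proof.
move NE: (_ + _) => N N0.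
have rot t a' b' : t != 0 ->
    t ^+ 2 * (a * p + b * r) = a' * N -> t ^+ 2 * (b * p - a * r) = b' * N ->
    alg_iso (gen a b p r) (gen a' b' 1 0).
  move=> t0 Ea Eb; pose s := t ^+ 4 / N.
  have s0 : s != 0 by rewrite mulf_neq0 ?invr_eq0 ?expf_neq0.
  have sE x y : t ^+ 2 * x = y * N -> t ^+ 2 * y = s * x.
    by move=> E; apply: (mulIf N0); rewrite -mulrA -E /s; field.
  (* This similarity sends (p, r) to s N (1, 0) = t^4 (1, 0), and (a, b) to s (a p + b r, b p - a
     r). *)
  apply: (gen_iso (t := t) (A := p * s) (B := - r * s) (C := r * s) (D := p * s)
            (c := s ^+ 2 * (p ^+ 2 + r ^+ 2))); do ?by ring.
  - by [].
  - by rewrite NE mulf_neq0 ?expf_neq0.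
  - by rewrite (sE _ _ Ea); ring.
  - by rewrite (sE _ _ Eb); ring.
  - transitivity (s * (p ^+ 2 + r ^+ 2)); last by ring.
    by rewrite NE divfK ?mulr1.
(* The scalar t makes the first new coordinate of (a, b) equal to 1 if it is nonzero, giving (3);
   otherwise it does so with the second, giving (2), unless both vanish, giving (1). *)
have [ab0 | ab0] := eqVneq (a * p + b * r) 0; last first.
  have [t t0 Et] := closed_sqrt (mulf_neq0 N0 (invr_neq0 ab0)).
  exists 3%N, (alg3 ((b * p - a * r) / (a * p + b * r))); split; first by constructor.
  by rewrite family3E; apply: (rot t); rewrite // Et; field.
have [ba0 | ba0] := eqVneq (b * p - a * r) 0; last first.
  have [t t0 Et] := closed_sqrt (mulf_neq0 N0 (invr_neq0 ba0)).
  exists 2%N, alg2; split; first by constructor.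
  by rewrite family2E; apply: (rot t); rewrite // Et ?ab0; field.
exists 1%N, alg1; split; first by constructor.
by rewrite family1E; apply: (rot 1); rewrite ?oner_neq0 ?ab0 ?ba0 ?mulr0 ?mul0r.
Qed.

Lemma gen_isotropic (a b p r : F) : p != 0 -> p ^+ 2 + r ^+ 2 = 0 ->
  exists k B, in_family i k B /\ alg_iso (gen a b p r) B.
Proof.
(* [e] is the sign for which (p, r) = p (1, e i). *)
move=> p0 pr0; pose e := r / (i * p).
have rE : r = e * i * p by rewrite -mulrA divfK ?mulf_neq0.
have e2 : e ^+ 2 = 1.
  apply: (mulIf (expf_neq0 2 p0)); rewrite mul1r -[RHS]subr0 -pr0 rE.
  by ring: i2.
(* The coordinates of (a, b) in the isotropic basis (1, e i), (1, - e i),    *)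
(* whose vectors are multiplied below by al and ga.                          *)
pose x := (a - e * i * b) / 2; pose y := (a + e * i * b) / 2.
(* The similarity sends (1, e i) to al (1, i) and (1, - e i) to ga (1, - i). The condition on (p, r)
   forces al = t^4 / p, while [ga] stays free. *)
have iso_ag t ga a' b' : t != 0 -> ga != 0 ->
    t ^+ 2 * a' = x * (t ^+ 4 / p) + y * ga ->
    t ^+ 2 * b' = i * (x * (t ^+ 4 / p) - y * ga) ->
  alg_iso (gen a b p r) (gen a' b' 1 i).
  move=> t0 ga0; set al := t ^+ 4 / p => Ea Eb.
  have alE : al * p = t ^+ 4 by rewrite divfK.
  have al0 : al != 0 by rewrite mulf_neq0 ?invr_eq0 ?expf_neq0.
  pose A := (al + ga) / 2; pose B := i * (al - ga) / 2.
  have AB : A ^+ 2 + B ^+ 2 = al * ga by rewrite /A /B; field: i2.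
  apply: (gen_iso (t := t) (A := A) (B := B) (C := - e * B) (D := e * A)
            (c := al * ga)) => //.
  - exact: mulf_neq0.
  - by rewrite -AB; ring: e2.
  - by ring.
  - by rewrite Ea /A /B /x /y; field: i2.
  - by rewrite Eb /A /B /x /y; field: i2.
  - by rewrite -alE rE /A /B; field: i2 e2.
  - by rewrite -alE rE /A /B; field: i2 e2.
clearbody x y.
have [x0 | x0] := eqVneq x 0; have [y0 | y0] := eqVneq y 0.
- exists 4%N, (alg4 i); split; first by constructor.
  by rewrite family4E; apply: (iso_ag 1 1); rewrite ?oner_neq0 // x0 y0; ring.
- exists 7%N, (alg7 i); split; first by constructor.
  rewrite family7E; apply: (iso_ag 1 y^-1);
    by rewrite ?oner_neq0 ?invr_eq0 // x0; field; rewrite y0 p0.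
- have [t t0 Et] := closed_sqrt (mulf_neq0 p0 (invr_neq0 x0)).
  exists 6%N, (alg6 i); split; first by constructor.
  rewrite family6E; apply: (iso_ag t 1);
    by rewrite ?oner_neq0 // (exprM t 2 2) Et y0; field; rewrite x0 p0.
(* The target (1, 0) is half the sum of (1, i) and (1, - i): the first coordinate asks for t^2 = p /
   (2 x), the second for ga = t^2 / (2 y). *)
have [t t0 Et] := closed_sqrt (mulf_neq0 p0 (invr_neq0 (mulf_neq0 two0 x0))).
exists 5%N, (alg5 i); split; first by constructor.
rewrite family5E; apply: (iso_ag t (t ^+ 2 / (2 * y))) => //.
- by rewrite mulf_neq0 ?expf_neq0 // invr_eq0 mulf_neq0.
- by rewrite (exprM t 2 2) Et; field; rewrite x0 y0 two0.
- by rewrite (exprM t 2 2) Et; field; rewrite x0 y0 two0.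
Qed.

Lemma type1211_classified (E : algebra F) :
    evolution_algebra E -> has_type E [:: 1; 2; 1; 1]%N ->
  exists k B, in_family i k B /\ alg_iso E B.
Proof.
move=> evE /(type1211_gen evE)[a [b [p [r [v0 isoE]]]]].
suff [k [B [Bk iso]]] : exists k B, in_family i k B /\ alg_iso (gen a b p r) B.
  by exists k, B; split=> //; apply: alg_iso_trans isoE iso.
have [pr0 | ] := eqVneq (p ^+ 2 + r ^+ 2) 0; last exact: gen_anisotropic.
apply: gen_isotropic => //; apply: contraTneq v0 => p0.
by move/eqP: pr0; rewrite p0 expr0n add0r sqrf_eq0 eqxx => ->.
Qed.

(** * Separation of the families *)

(* Up to nonzero factors, an isomorphism preserves the quadratic form
   [x^2 + y^2] on [(a, b)] and on [(p, r)], and their inner product. *)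
Definition gen_inv (a b p r : F) : bool * bool * bool * bool :=
  (p ^+ 2 + r ^+ 2 == 0, (a == 0) && (b == 0), a * p + b * r == 0,
   (p ^+ 2 + r ^+ 2 == 0) && (a ^+ 2 + b ^+ 2 == 0)).

Lemma gen_inv_iso (a b p r a' b' p' r' : F) :
    (p' != 0) || (r' != 0) -> alg_iso (gen a b p r) (gen a' b' p' r') ->
  gen_inv a b p r = gen_inv a' b' p' r'.
Proof.
move=> v'0 /(gen_isoP v'0)[t [A [B [C [D [c [[t0 c0 AB CD ABCD] Ea Eb Ep Er]]]]]]].
have t_eq0 m z : (t ^+ m * z == 0) = (z == 0).
  by rewrite mulf_eq0 expf_eq0 (negPf t0) andbF.
have c_eq0 z : (c * z == 0) = (z == 0) by rewrite mulf_eq0 (negPf c0).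
have form x y z w : (A * x + C * y) * (A * z + C * w)
    + (B * x + D * y) * (B * z + D * w) = c * (x * z + y * w).
  transitivity ((A ^+ 2 + B ^+ 2) * (x * z) + (C ^+ 2 + D ^+ 2) * (y * w)
               + (A * C + B * D) * (x * w + y * z)); first by ring.
  by rewrite AB CD ABCD; ring.
have Qv : (p' ^+ 2 + r' ^+ 2 == 0) = (p ^+ 2 + r ^+ 2 == 0).
  rewrite -(t_eq0 8) -(c_eq0 (p ^+ 2 + _)) !expr2 -form -Ep -Er.
  by congr (_ == 0); ring.
have Qu : (a' ^+ 2 + b' ^+ 2 == 0) = (a ^+ 2 + b ^+ 2 == 0).
  rewrite -(t_eq0 4) -(c_eq0 (a ^+ 2 + _)) !expr2 -form -Ea -Eb.
  by congr (_ == 0); ring.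
have Buv : (a' * p' + b' * r' == 0) = (a * p + b * r == 0).
  rewrite -(t_eq0 6) -(c_eq0 (a * p + _)) -form -Ea -Eb -Ep -Er.
  by congr (_ == 0); ring.
rewrite /gen_inv Qv Qu Buv; congr (_, _, _, _).
rewrite -(t_eq0 2 a') -(t_eq0 2 b') Ea Eb.
apply/andP/andP=> -[/eqP a0 /eqP b0]; first by rewrite a0 b0 !mulr0 addr0 eqxx.
(* If the image of (a, b) vanishes, then (a, b) is orthogonal to every vector, and the form is
   nondegenerate. *)
have Eab x y : a * x + b * y = 0.
  by have /esym/eqP := form a b x y; rewrite a0 b0 !mul0r addr0 c_eq0 => /eqP.
by have := Eab 1 0; have := Eab 0 1; rewrite !(mulr0, mulr1, addr0, add0r) => -> ->.
Qed.

(* The entry 0 stands for no family; it only keeps the list duplicate-free. *)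
Definition family_inv (k : nat) : bool * bool * bool * bool :=
  nth (true, true, false, false)
    [:: (true, true, false, false); (false, true, true, false);
        (false, false, true, false); (false, false, false, false);
        (true, true, true, true); (true, false, false, false);
        (true, false, true, true); (true, false, false, true)] k.

Lemma family_inv_inj k l : (k < 8)%N -> (l < 8)%N ->
  family_inv k = family_inv l -> k = l.
Proof. by move=> ltk ltl /eqP; rewrite nth_uniq // => /eqP. Qed.

(** In (3), a^2 + b^2 = 1 + beta^2 may vanish, but p^2 + r^2 = 1 makes the last entry false for
    every beta. Families (6) and (7) differ in a p + b r, which is 0 in one and 2 in the other. *)
Lemma in_family_gen k A : in_family i k A ->
  (k < 8)%N /\ exists a b p r, [/\ A = gen a b p r, (p != 0) || (r != 0) &
    gen_inv a b p r = family_inv k].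
Proof.
have n10 : (1 == 0 :> F) = false by rewrite oner_eq0.
have n20 : (1 + 1 == 0 :> F) = false by apply/negbTE; exact: two0.
have ii : i * i = -1 by rewrite -expr2.
case=> [||beta||||]; split=> //;
  [ exists 0, 0, 1, 0; rewrite family1E | exists 0, 1, 1, 0; rewrite family2E
  | exists 1, beta, 1, 0; rewrite family3E | exists 0, 0, 1, i; rewrite family4E
  | exists 1, 0, 1, i; rewrite family5E | exists 1, i, 1, i; rewrite family6E
  | exists 1, (- i), 1, i; rewrite family7E ]; split=> //; rewrite ?n10 //;
  rewrite /gen_inv /family_inv /= !expr2 ?mulrN ?mulNr ?opprK ?ii
    ?(mul1r, mulr1, mul0r, mulr0, addr0, add0r, subrr, opprK, n10, n20, eqxx,
      oppr_eq0) //.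
Qed.

Lemma in_family_not_iso k l A B :
  in_family i k A -> in_family i l B -> k <> l -> ~ alg_iso A B.
Proof.
move=> /in_family_gen[ltk [a [b [p [r [-> _ invA]]]]]].
move=> /in_family_gen[ltl [a' [b' [p' [r' [-> v'0 invB]]]]]] nkl iso.
by apply/nkl/family_inv_inj; rewrite // -invA -invB (gen_inv_iso v'0 iso).
Qed.

(** Sending (1, 0) to t^4 (1, 0) gives A = t^4 and B = 0, then orthogonality gives C = 0. The first
    coordinate of (1, beta) now yields t^2 = t^4, so t^2 = 1, c = 1 and D = ±1. Conversely, changing
    the sign of e4 changes that of beta. *)
Lemma alg3_isoP (beta beta' : F) :
  alg_iso (alg3 beta) (alg3 beta') <-> beta' = beta \/ beta' = - beta.
Proof.
rewrite !family3E; split=> [|beta'E].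
  have v0 : (1 != 0 :> F) || (0 != 0 :> F) by rewrite oner_neq0.
  move=> /(gen_isoP v0)[t [A [B [C [D [c [[t0 c0 AB CD ABCD] Ea Eb Ep Er]]]]]]].
  move: Ea Ep Er; rewrite !(mulr1, mulr0, addr0) => Ea Ep Er.
  move: ABCD AB Eb; rewrite -Er -Ep mul0r addr0 expr0n /= addr0 mul0r add0r.
  move=> /eqP; rewrite mulf_eq0 expf_eq0 (negPf t0) /= => /eqP C0 Ec Eb.
  have t2 : t ^+ 2 = 1.
    apply: (mulfI (expf_neq0 2 t0)); rewrite mulr1 -exprD [in RHS]Ea -Ep C0 mul0r.
    by rewrite addr0.
  move: Eb CD; rewrite -Ec C0 (exprM t 2 2) t2 !expr1n expr0n /= add0r mul1r => -> /eqP.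
  by rewrite sqrf_eq1 => /orP[]/eqP->; [left; rewrite mul1r | right; rewrite mulN1r].
have [D D2 DE] : exists2 D, D ^+ 2 = 1 & beta' = D * beta.
  case: beta'E => ->; [exists 1 | exists (-1)]; rewrite ?mul1r ?mulN1r //.
    by rewrite expr1n.
  by rewrite sqrrN expr1n.
by apply: (gen_iso (t := 1) (A := 1) (B := 0) (C := 0) (D := D) (c := 1));
  rewrite ?oner_neq0 ?D2 ?DE //; ring.
Qed.

End Classification.

Theorem theorem6p6 (F : closedFieldType) (charF : 2%N \notin [pchar F])
    (i : F) (i2 : i ^+ 2 = -1) :
  [/\ forall E : algebra F,
        evolution_algebra E -> nilpotent_alg E -> has_type E [:: 1; 2; 1; 1]%N ->
        exists k (A : algebra F), in_family i k A /\ alg_iso E A,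
      forall (k l : nat) (A B : algebra F),
        in_family i k A -> in_family i l B -> k <> l -> ~ alg_iso A B
    & forall beta beta' : F,
        alg_iso (alg3 beta) (alg3 beta') <-> beta' = beta \/ beta' = - beta].
Proof.
split=> [E evE _ typeE | k l A B | beta beta'].
- exact: type1211_classified.
- exact: in_family_not_iso.
- exact: alg3_isoP.
Qed.
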